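(* Let $G$ be a connected graph with at least $4$ vertices. Then $G$ is a contact graph of rectangles (i.e. admits a rectangular layout) if and only if $G$ has a planar, weak, closed rectangle of influence drawing.
   Context: A (strong) rectangular layout of $G=(V,E)$ is a set of axis-parallel rectangles with pairwise disjoint interiors, in bijection $\mathcal{R}$ with $V$, such that for distinct $u,v$ the boundaries of $\mathcal{R}(u)$ and $\mathcal{R}(v)$ share a segment of positive length if and only if $\{u,v\}\in E$. A weak closed rectangle of influence drawing of $G$ is a straight-line drawing of $G$ (vertices at distinct points, edges as segments) such that for every edge $\{u,v\}$, the closed axis-parallel rectangle having $u$ and $v$ as opposite corners (including its boundary; possibly degenerate) contains no other vertex. It is planar if no two edges cross. Throughout the paper, graphs are assumed connected with at least $4$ vertices. *)

(* Defs.v *)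
From mathcomp Require Export all_boot all_order all_algebra.
From mathcomp Require Export boolp classical_sets reals.
Set Implicit Arguments.
Unset Strict Implicit.
Unset Printing Implicit Defensive.
Import Order.TTheory GRing.Theory Num.Theory.
Local Open Scope ring_scope.
Local Open Scope classical_set_scope.

Section Geometry.
Variable R : realType.
Implicit Types p q : R * R.

Definition segment p q : set (R * R) :=
  [set ((1 - t) * p.1 + t * q.1, (1 - t) * p.2 + t * q.2)
    | t in [set t : R | 0 <= t <= 1]].

Record rectangle := Rectangle {
  xmin : R; xmax : R; ymin : R; ymax : R;
  xmin_lt_xmax : xmin < xmax;
  ymin_lt_ymax : ymin < ymax }.

Implicit Types r s : rectangle.

Definition rect_closed r : set (R * R) :=
  [set z | xmin r <= z.1 <= xmax r /\ ymin r <= z.2 <= ymax r].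

Definition rect_interior r : set (R * R) :=
  [set z | xmin r < z.1 < xmax r /\ ymin r < z.2 < ymax r].

Definition rect_boundary r : set (R * R) := rect_closed r `\` rect_interior r.

Definition share_segment r s : Prop :=
  exists p q, p <> q /\ segment p q `<=` rect_boundary r `&` rect_boundary s.

Definition influence_rect p q : set (R * R) :=
  [set z | Num.min p.1 q.1 <= z.1 <= Num.max p.1 q.1
        /\ Num.min p.2 q.2 <= z.2 <= Num.max p.2 q.2].

End Geometry.

Section Graphs.
Variables (R : realType) (V : finType) (E : rel V).

(* [rho] is automatically injective: rectangles have nonempty interior. *)
Definition rectangular_layout (rho : V -> rectangle R) : Prop :=
  (forall u v, u <> v ->
     rect_interior (rho u) `&` rect_interior (rho v) = set0) /\
  (forall u v, u <> v -> (share_segment (rho u) (rho v) <-> E u v)).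

(* A straight-line drawing is determined by the positions of its vertices. *)
Definition weak_closed_RI_drawing (pos : V -> R * R) : Prop :=
  injective pos /\
  (forall u v, E u v ->
     forall w, influence_rect (pos u) (pos v) (pos w) -> w = u \/ w = v).

(* Distinct edges meet at most in the image of a common end vertex. *)
Definition planar_drawing (pos : V -> R * R) : Prop :=
  forall u v x y, E u v -> E x y ->
    [set u; v] <> [set x; y] :> set V ->
    segment (pos u) (pos v) `&` segment (pos x) (pos y)
      `<=` pos @` ([set u; v] `&` [set x; y]).

Definition rectangle_contact_graph : Prop :=
  exists rho : V -> rectangle R, rectangular_layout rho.

Definition has_planar_weak_closed_RI_drawing : Prop :=
  exists pos : V -> R * R, weak_closed_RI_drawing pos /\ planar_drawing pos.

End Graphs.

(* Main.v *)
Require Import Defs.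
From mathcomp Require Import all_boot all_order all_algebra.
From mathcomp Require Import reals.
From mathcomp Require Import zify ring lra.

(* Both sides are equivalent to the existence of injective integer coordinates
   f, g on the vertices such that the rectangle spanned by an edge contains no
   other vertex and no such rectangle is pierced by another one ([noncrossing]).

   From a layout, f and g are linear extensions of the relations "left of or
   above" and "left of or below", which are acyclic on interior-disjoint
   rectangles. From a drawing, f and g are the coordinates with ties broken.
   Conversely such coordinates form a planar drawing as they stand.

   To build rectangles, add edges as long as [noncrossing] is preserved. For the
   resulting maximal graph, the horizontal extent of a vertex is read off by
   counting "vertical lines": maximal descending chains of vertices that no edge
   jumps over. Vertical extents are obtained in the same way after g -> -g. Every
   non-adjacent pair is then strictly separated, so that the extra edges can be
   removed one at a time by a small shift of the sides on one line. *)

Set Implicit Arguments.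
Unset Strict Implicit.
Unset Printing Implicit Defensive.
Import Order.TTheory GRing.Theory Num.Theory.
Local Open Scope ring_scope.

(** * From layouts to noncrossing coordinates *)

(** Taking off minimal elements one at a time lists the vertices in an order compatible with [D]. *)
Lemma topological_sort (V : finType) (D : rel V) :
    (forall S : pred V, (exists u, S u) ->
       exists2 u, S u & forall v, S v -> ~~ D v u) ->
  exists2 f : V -> nat, injective f & forall u v, D u v -> (f u < f v)%N.
Proof.
move=> minD.
have sortS n (S : pred V) : (#|S| <= n)%N ->
    exists2 f : V -> nat, {in S &, injective f} &
      forall u v, S u -> S v -> D u v -> (f u < f v)%N; last first.
  have [f injf fD] := sortS #|V| predT (max_card _).
  by exists f => [u v|u v]; [apply: injf|apply: fD].
elim: n S => [|n IHn] S leSn.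
  have S0 u : S u -> False.
    by move=> Su; move: leSn; rewrite leqn0 => /eqP/card0_eq/(_ u); rewrite -topredE /= Su.
  by exists (fun=> 0%N) => [u v|u v] Su; case: (S0 u Su).
have [[u0 Su0]|S0] := pselect (exists u, S u); last first.
  by exists (fun=> 0%N) => [u v|u v] Su; case: S0; exists u.
have [u Su minu] := minD S (ex_intro _ u0 Su0).
have [|f injf fD] := IHn (fun v => S v && (v != u)).
  move: leSn; rewrite (cardD1 u) [u \in S]Su add1n ltnS; apply: leq_trans.
  by apply: subset_leq_card; apply/fintype.subsetP => v; rewrite !inE andbC.
(* The minimal [u] gets rank 0 and all other ranks move up by one. *)
exists (fun v => if v == u then 0%N else (f v).+1) => [v w Sv Sw|v w Sv Sw Dvw].
  case: eqVneq => [->|vu]; case: eqVneq => [->|wu] //= [].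
  by apply: injf; rewrite -topredE /= ?vu ?wu andbT.
have wu : w != u by apply/eqP => wu; move: (minu _ Sv); rewrite -wu Dvw.
rewrite (negPf wu); case: eqVneq => // vu; rewrite ltnS.
by apply: fD => //; rewrite ?vu ?wu andbT.
Qed.

Lemma injective_refinement (R : realType) (V : finType) (x : V -> R) :
  exists2 f : V -> nat, injective f & forall u v, x u < x v -> (f u < f v)%N.
Proof.
apply: topological_sort => S [u0 Su0].
have [u Su minu] := arg_minP x Su0.
by exists u => // v Sv; rewrite -leNgt minu.
Qed.

Section Crossing.
Variables (V : finType) (f g : V -> int).

Definition between (a b c : int) := (a < b < c) || (c < b < a).

(** The open rectangle suffices: with injective [f] and [g], no third vertex lies on its
    boundary. *)
Definition in_rect u v w := between (f u) (f w) (f v) && between (g u) (g w) (g v).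

(* The rectangle of [u], [v] is pierced vertically by the one of [x], [y]. *)
Definition cross u v x y :=
  [&& f u < f x, f u < f y, f x < f v, f y < f v,
      g x < g u, g x < g v, g u < g y & g v < g y].

Definition noncrossing (E : rel V) :=
  (forall u v w, E u v -> ~~ in_rect u v w) /\
  (forall u v x y, E u v -> E x y -> ~~ cross u v x y).

Definition ascending u v := (f u < f v) && (g u < g v).
Definition descending u v := (f u < f v) && (g v < g u).

End Crossing.

Section LayoutToDrawing.
Variables (R : realType) (V : finType) (E : rel V) (rho : V -> rectangle R).
Hypothesis layout : rectangular_layout E rho.

Local Notation xl v := (xmin (rho v)).
Local Notation xr v := (xmax (rho v)).
Local Notation yl v := (ymin (rho v)).
Local Notation yr v := (ymax (rho v)).

Lemma layout_separated u v : u != v ->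
  [\/ xr u <= xl v, xr v <= xl u, yr u <= yl v | yr v <= yl u].
Proof.
move=> /eqP uv; have [disj _] := layout.
have := disj u v uv; have := xmin_lt_xmax (rho u); have := xmin_lt_xmax (rho v).
have := ymin_lt_ymax (rho u); have := ymin_lt_ymax (rho v).
move=> yv yu xv xu d.
have [?|h1] := leP (xr u) (xl v); first by apply: Or41.
have [?|h2] := leP (xr v) (xl u); first by apply: Or42.
have [?|h3] := leP (yr u) (yl v); first by apply: Or43.
have [?|h4] := leP (yr v) (yl u); first by apply: Or44.
have btw (a b a' b' : R) : a < b -> a' < b' -> a < b' -> a' < b ->
    exists z, [/\ a < z, z < b, a' < z & z < b'].
  move=> *; exists ((Num.max a a' + Num.min b b') / 2).
  by rewrite /Num.max /Num.min; do 2 (case: ifP => ?); split; lra.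
have [x [? ? ? ?]] := btw _ _ _ _ xu xv h2 h1.
have [y [? ? ? ?]] := btw _ _ _ _ yu yv h4 h3.
suff : classical_sets.set0 (x, y) by [].
by rewrite -d; split; split; apply/andP.
Qed.

(** Both ends of the common segment lie in both closed rectangles; they differ in one coordinate,
    and in that direction the overlap is strict. *)
Lemma share_segment_overlap (r s : rectangle R) : share_segment r s ->
  [/\ xmin r <= xmax s, xmin s <= xmax r, ymin r <= ymax s & ymin s <= ymax r]
  /\ ((xmin r < xmax s /\ xmin s < xmax r) \/ (ymin r < ymax s /\ ymin s < ymax r)).
Proof.
move=> [[p1 p2] [[q1 q2] [pq sub]]].
have [[] [/andP[/= r1 r2] /andP[/= r3 r4]] _ [] [/andP[/= s1 s2] /andP[/= s3 s4]] _] :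
    (rect_boundary r `&` rect_boundary s)%classic (p1, p2).
  by apply: sub; exists 0; [rewrite /= lexx ler01|congr pair; rewrite /=; ring].
have [[] [/andP[/= r5 r6] /andP[/= r7 r8]] _ [] [/andP[/= s5 s6] /andP[/= s7 s8]] _] :
    (rect_boundary r `&` rect_boundary s)%classic (q1, q2).
  by apply: sub; exists 1; [rewrite /= lexx ler01|congr pair; rewrite /=; ring].
split; first by split; lra.
have [p1q|p1q|p1q] := ltgtP p1 q1; [left; split; lra|left; split; lra|].
have [p2q|p2q|p2q] := ltgtP p2 q2; [right; split; lra|right; split; lra|].
by case: pq; rewrite p1q p2q.
Qed.

End LayoutToDrawing.

(* Among the rectangles without a predecessor on their left, the highest one is
   minimal: otherwise its leftmost predecessor would be such a rectangle too. *)
Lemma corner_order_minimal (R : realType) (V : finType) (a b c d : V -> R)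
    (S : pred V) :
    (forall v, a v < b v) -> (forall v, c v < d v) ->
    (forall u v, u != v ->
       [\/ b u <= a v, b v <= a u, d u <= c v | d v <= c u]) ->
    (exists u, S u) ->
  exists2 u, S u & forall v, S v -> ~~ [&& v != u, a v < b u & c u < d v].
Proof.
move=> ab cd sep [u0 Su0]; pose D v u := [&& v != u, a v < b u & c u < d v].
pose P u := S u && [forall v, S v ==> D v u ==> (a u < b v)].
have [u1 Su1 min1] := arg_minP a Su0.
have Pu1 : P u1.
  apply/andP; split=> //; apply/forallP => v; apply/implyP => Sv; apply/implyP => _.
  exact: le_lt_trans (min1 v Sv) (ab v).
have [u Pu maxu] := arg_maxP c Pu1; case/andP: (Pu) => Su /forallP noleft.
exists u => // v0 Sv0; apply/negP => Dv0.
have [v /andP[Sv Dv] minv] := @arg_minP _ _ _ v0 (fun v => S v && D v u) a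
  (introT andP (conj Sv0 Dv0)).
have := noleft v; rewrite Sv Dv /= => auv.
have [vu avu cuv] := and3P Dv.
have dcuv : d u <= c v by case: (sep _ _ vu) => // ?; lra.
have := cd u; have := cd v; have := ab u; have := ab v => abv abu cdv cdu.
suff /maxu : P v by rewrite /=; lra.
rewrite /P Sv; apply/forallP => w; apply/implyP => Sw; apply/implyP => /and3P[wv awv cvw].
rewrite ltNge; apply/negP => bwa; have abw := ab w.
have : S w && D w u.
  rewrite Sw /=; apply/and3P; split; [|lra|lra].
  by apply/eqP => wu; move: bwa; rewrite wu; lra.
by move/minv; lra.
Qed.

(** If [f u < f v], then [u] is left of [v] or above it, since otherwise [v] would be sorted first.
    Likewise [g u < g v] leaves left or below. Where the two orders agree, only left remains; where
    they disagree, only above. *)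
Lemma layout_ranks (R : realType) (V : finType) (E : rel V)
    (rho : V -> rectangle R) : rectangular_layout E rho ->
  exists f g : V -> nat, [/\ injective f, injective g,
    forall u v, (f u < f v)%N -> (g u < g v)%N -> xmax (rho u) <= xmin (rho v) &
    forall u v, (f u < f v)%N -> (g v < g u)%N -> ymax (rho v) <= ymin (rho u)].
Proof.
move=> lay; have sep := layout_separated lay.
have xlt v := xmin_lt_xmax (rho v); have ylt v := ymin_lt_ymax (rho v).
have [S|f injf fD] := @topological_sort V (fun v u => [&& v != u,
    xmin (rho v) < xmax (rho u) & ymin (rho u) < ymax (rho v)]).
  exact: corner_order_minimal.
have [S|g injg gD] := @topological_sort V (fun v u => [&& v != u,
    xmin (rho v) < xmax (rho u) & - ymax (rho u) < - ymin (rho v)]).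
  (* The second order is the first one after turning the layout upside down: vertical extents become
     [[- ymax, - ymin]]. *)
  apply: (corner_order_minimal (c := fun v => - ymax (rho v))) => // [v|u v uv].
    by rewrite ltrN2.
  by case: (sep u v uv) => ?; [constructor 1|constructor 2|constructor 4|constructor 3] => //;
     rewrite lerN2.
have nf u v : (f u < f v)%N -> xmax (rho u) <= xmin (rho v) \/ ymax (rho v) <= ymin (rho u).
  move=> fuv; have [?|h1] := leP (xmax (rho u)) (xmin (rho v)); first by left.
  have [?|h2] := leP (ymax (rho v)) (ymin (rho u)); first by right.
  suff : (f v < f u)%N by lia.
  by apply: fD; rewrite h1 h2 !andbT; apply: contraTneq fuv => ->; rewrite ltnn.
have ng u v : (g u < g v)%N -> xmax (rho u) <= xmin (rho v) \/ ymax (rho u) <= ymin (rho v).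
  move=> guv; have [?|h1] := leP (xmax (rho u)) (xmin (rho v)); first by left.
  have [?|h2] := leP (ymax (rho u)) (ymin (rho v)); first by right.
  suff : (g v < g u)%N by lia.
  by apply: gD; rewrite h1 ltrN2 h2 !andbT; apply: contraTneq guv => ->; rewrite ltnn.
exists f, g; split=> // u v /nf fuv /ng guv; have := (xlt u, xlt v, ylt u, ylt v);
  case=> [[[]]]; case: fuv; case: guv; lra.
Qed.

(** A vertex [w] with both ranks between those of [u] and [v] has its rectangle between theirs in
    one direction. Its positive extent keeps them from touching. *)
Lemma layout_noncrossing (R : realType) (V : finType) (E : rel V)
    (rho : V -> rectangle R) :
    irreflexive E -> rectangular_layout E rho ->
  exists f g : V -> nat, [/\ injective f, injective g &
    noncrossing (Posz \o f) (Posz \o g) E].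
Proof.
move=> Eirr lay; have [f [g [injf injg fg_left fg_above]]] := layout_ranks lay.
exists f, g; split=> //.
have xlt v := xmin_lt_xmax (rho v); have ylt v := ymin_lt_ymax (rho v).
have share u v : E u v -> share_segment (rho u) (rho v).
  move=> Euv; apply/(lay.2 u v) => // uv.
  by move: Euv; rewrite uv Eirr.
split=> [u v w /share/share_segment_overlap[[x1 x2 y1 y2] o]|].
  have := (xlt w, ylt w); case=> xw yw.
  apply/negP => /andP[/orP[]/andP[h1 h2] /orP[]/andP[h3 h4]].
  - have := fg_left u w h1 h3; have := fg_left w v h2 h4; lra.
  - have := fg_above u w h1 h4; have := fg_above w v h2 h3; lra.
  - have := fg_above v w h1 h4; have := fg_above w u h2 h3; lra.
  - have := fg_left v w h1 h3; have := fg_left w u h2 h4; lra.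
move=> u v x y /share/share_segment_overlap[[x1 x2 y1 y2] o].
move=> /share/share_segment_overlap[[x3 x4 y3 y4] o'].
(* The four rectangles form a pinwheel: [u] is above [x] and left of [y], [v] is right of [x] and
   below [y]. A strict overlap of [u] and [v] in one direction pulls [x] and [y] apart in that
   direction. *)
apply/negP => /and5P[h1 h2 h3 h4 /and4P[h5 h6 h7 h8]].
have := fg_above u x h1 h5; have := fg_left u y h2 h7.
have := fg_left x v h3 h6; have := fg_above y v h4 h8.
by case: o => -[? ?]; case: o' => -[? ?]; lra.
Qed.

(** * Noncrossing coordinates are planar drawings *)

(** Either an axis-parallel line separates the two edges, or they slope the same way and both ends
    of one are displaced from those of the other across this slope. The proof runs through all
    relative orders of the coordinates. *)
Lemma rect_pair_cases (u1 u2 v1 v2 x1 x2 y1 y2 : nat) :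
  (u1 < v1)%N -> (x1 < y1)%N ->
  [&& u1 != x1, u1 != y1, v1 != x1, v1 != y1,
      u2 != x2, u2 != y2, v2 != x2 & v2 != y2] ->
  u2 != v2 -> x2 != y2 ->
  ~~ (between u1 x1 v1 && between u2 x2 v2) ->
  ~~ (between u1 y1 v1 && between u2 y2 v2) ->
  ~~ (between x1 u1 y1 && between x2 u2 y2) ->
  ~~ (between x1 v1 y1 && between x2 v2 y2) ->
  ~~ [&& u1 < x1, u1 < y1, x1 < v1, y1 < v1,
         x2 < u2, x2 < v2, u2 < y2 & v2 < y2]%N ->
  ~~ [&& u1 < y1, u1 < x1, y1 < v1, x1 < v1,
         y2 < u2, y2 < v2, u2 < x2 & v2 < x2]%N ->
  ~~ [&& x1 < u1, x1 < v1, u1 < y1, v1 < y1,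
         u2 < x2, u2 < y2, x2 < v2 & y2 < v2]%N ->
  ~~ [&& x1 < v1, x1 < u1, v1 < y1, u1 < y1,
         v2 < x2, v2 < y2, x2 < u2 & y2 < u2]%N ->
  [|| (v1 < x1), (y1 < u1), [&& u2 < x2, u2 < y2, v2 < x2 & v2 < y2],
     [&& x2 < u2, y2 < u2, x2 < v2 & y2 < v2],
     [&& u1 < x1, v1 < y1,
         u2 < x2, v2 < y2, v2 < u2 & y2 < x2],
     [&& x1 < u1, y1 < v1,
         x2 < u2, y2 < v2, v2 < u2 & y2 < x2],
     [&& x1 < u1, y1 < v1,
         u2 < x2, v2 < y2, u2 < v2 & x2 < y2] |
     [&& u1 < x1, v1 < y1,
         x2 < u2, y2 < v2, u2 < v2 & x2 < y2]]%N.
Proof.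
rewrite /between; case: (ltngtP u2 v2) => // ?; case: (ltngtP x2 y2) => // ?.
all: case: (ltngtP u1 x1) => //= ?; case: (ltngtP u1 y1) => //= ?.
all: case: (ltngtP v1 x1) => //= ?; case: (ltngtP v1 y1) => //= ?.
all: case: (ltngtP u2 x2) => //= ?; case: (ltngtP u2 y2) => //= ?.
all: case: (ltngtP v2 x2) => //= ?; case: (ltngtP v2 y2) => //= ?.
all: lia.
Qed.

Lemma segmentC (R : realType) (p q z : R * R) : segment p q z -> segment q p z.
Proof.
case=> t /andP[t0 t1] <-; exists (1 - t); first by apply/andP; split; lra.
by congr pair; ring.
Qed.

(** Here [b] divides the way from [a] to [c] in the ratio [t / s], strictly between 0 and 1. *)
Lemma between_of_scaled (R : realType) (s t : R) (a b c : nat) :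
    0 < t < s -> s * (b%:R - a%:R) = t * (c%:R - a%:R) -> b != a ->
  between a b c.
Proof.
move=> /andP[t0 ts] e ba; apply/orP.
have [lt_ba|lt_ab|eq_ba] := ltngtP b a; last by rewrite eq_ba eqxx in ba.
  have : (b%:R : R) < a%:R by rewrite ltr_nat.
  move=> ?; right; suff : (c%:R : R) < b%:R by rewrite ltr_nat; lia.
  by nra.
have : (a%:R : R) < b%:R by rewrite ltr_nat.
move=> ?; left; suff : (b%:R : R) < c%:R by rewrite ltr_nat; lia.
by nra.
Qed.

Lemma ltr_conv (R : realType) (t a b c d : R) : 0 <= t <= 1 -> a < c -> b < d ->
  (1 - t) * a + t * b < (1 - t) * c + t * d.
Proof.
move=> /andP[t0 t1] ac bd; have [->|tn1] := eqVneq t 1; first by lra.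
have : 0 < 1 - t by rewrite subr_gt0 lt_neqAle tn1.
by nra.
Qed.

Lemma ltr_conv2 (R : realType) (s t a b c d : R) :
    0 <= s <= 1 -> 0 <= t <= 1 -> a < c -> a < d -> b < c -> b < d ->
  (1 - s) * a + s * b < (1 - t) * c + t * d.
Proof.
move=> s01 t01 ac ad bc bd.
have := ltr_conv s01 ac bc; have := ltr_conv s01 ad bd.
rewrite -!mulrDl !subrK !mul1r => wd wc; have := ltr_conv t01 wc wd.
by rewrite -mulrDl subrK mul1r.
Qed.

Lemma conv_lt_incr (R : realType) (s t a b : R) : a < b ->
  (1 - t) * a + t * b < (1 - s) * a + s * b -> t < s.
Proof.
move=> ab h; rewrite -subr_gt0 -(pmulr_lgt0 _ (_ : 0 < b - a)) ?subr_gt0 //.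
by lra.
Qed.

Section NoncrossingPlanar.
Variables (R : realType) (V : finType) (E : rel V) (f g : V -> nat).
Hypotheses (E_sym : symmetric E) (E_irr : irreflexive E).
Hypotheses (injf : injective f) (injg : injective g).
Hypothesis ncE : noncrossing (Posz \o f) (Posz \o g) E.

Let pos (v : V) : R * R := ((f v)%:R, (g v)%:R).

Lemma noncrossing_weak_closed_RI : weak_closed_RI_drawing E pos.
Proof.
split=> [u v [/eqP]|u v Euv w].
  by rewrite eqr_nat => /eqP/injf.
rewrite /influence_rect /pos /= /Num.min /Num.max !ltr_nat.
have ifR (b : bool) (m n : nat) :
  (if b then m%:R else n%:R) = (if b then m else n)%:R :> R by case: b.
rewrite !ifR !ler_nat => -[h1 h2].
have [->|wu] := eqVneq w u; first by left.
have [->|wv] := eqVneq w v; first by right.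
have := ncE.1 u v w Euv; rewrite /in_rect /between /=.
have : f w != f u by rewrite (inj_eq injf).
have : f w != f v by rewrite (inj_eq injf).
have : g w != g u by rewrite (inj_eq injg).
have : g w != g v by rewrite (inj_eq injg).
by move: h1 h2; case: (ltnP (f u)); case: (ltnP (g u)) => *; exfalso; lia.
Qed.

(** If the segments met away from [u], they would point in the same direction, and the end of the
    shorter one would lie in the rectangle of the longer one. *)
Lemma star_segments u v w z : E u v -> E u w -> v != w ->
  segment (pos u) (pos v) z -> segment (pos u) (pos w) z -> z = pos u.
Proof.
move=> Euv Euw vw [s /andP[s0 s1] <-] [t /andP[t0 t1] /= [e1 e2]].
have {}e1 : s * ((f v)%:R - (f u)%:R) = t * ((f w)%:R - (f u)%:R) :> R by lra.
have {}e2 : s * ((g v)%:R - (g u)%:R) = t * ((g w)%:R - (g u)%:R) :> R by lra.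
move: s0; rewrite le_eqVlt => /orP[/eqP <-|s0]; first by congr pair; rewrite /=; ring.
move: t0; rewrite le_eqVlt => /orP[/eqP t0|t0].
  move: e1 e2; rewrite -t0 !mul0r => /eqP; rewrite mulf_eq0 gt_eqF //= => /eqP e1 /eqP.
  by rewrite mulf_eq0 gt_eqF //= => /eqP e2; congr pair; rewrite /=; nra.
have neq x : E u x -> (f x != f u) && (g x != g u).
  move=> Eux; rewrite (inj_eq injf) (inj_eq injg) andbb; apply/eqP => xu.
  by rewrite xu E_irr in Eux.
have /andP[fvu gvu] := neq _ Euv; have /andP[fwu gwu] := neq _ Euw.
have [ts|st|ts] := ltgtP t s.
- have := ncE.1 u w v Euw; rewrite /in_rect.
  by rewrite !(@between_of_scaled _ s t) ?t0.
- have := ncE.1 u v w Euv; rewrite /in_rect.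
  by rewrite !(@between_of_scaled _ t s) ?s0.
- move: e1; rewrite ts => /(mulfI (lt0r_neq0 s0))/addIr/eqP.
  by rewrite eqr_nat (inj_eq injf) (negPf vw).
Qed.

Lemma noncrossing_edges_disjoint u v x y z : E u v -> E x y ->
    [&& u != x, u != y, v != x & v != y] ->
  segment (pos u) (pos v) z -> segment (pos x) (pos y) z -> False.
Proof.
wlog fuv : u v / (f u < f v)%N => [wlg Euv Exy /and4P[ux uy vx vy] zuv zxy|].
  have [fuv|fvu|/injf uv] := ltngtP (f u) (f v).
  - by apply: (wlg u v) => //; apply/and4P.
  - apply: (wlg v u) => //; [by rewrite E_sym|by apply/and4P|exact: segmentC].
  - by rewrite uv E_irr in Euv.
wlog fxy : x y / (f x < f y)%N => [wlg Euv Exy /and4P[ux uy vx vy] zuv zxy|].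
  have [fxy|fyx|/injf xy] := ltngtP (f x) (f y).
  - by apply: (wlg x y) => //; apply/and4P.
  - apply: (wlg y x) => //; [by rewrite E_sym|by apply/and4P|exact: segmentC].
  - by rewrite xy E_irr in Exy.
move=> Euv Exy /and4P[ux uy vx vy].
have Evu : E v u by rewrite E_sym.
have Eyx : E y x by rewrite E_sym.
have uv : u != v by apply: contraTneq fuv => ->; rewrite ltnn.
have xy : x != y by apply: contraTneq fxy => ->; rewrite ltnn.
have cases : [|| (f v < f x), (f y < f u),
     [&& g u < g x, g u < g y, g v < g x & g v < g y],
     [&& g x < g u, g y < g u, g x < g v & g y < g v],
     [&& f u < f x, f v < f y, g u < g x, g v < g y, g v < g u & g y < g x],
     [&& f x < f u, f y < f v, g x < g u, g y < g v, g v < g u & g y < g x],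
     [&& f x < f u, f y < f v, g u < g x, g v < g y, g u < g v & g x < g y] |
     [&& f u < f x, f v < f y, g x < g u, g y < g v, g u < g v & g x < g y]]%N.
  have nc1 := ncE.2 u v x y Euv Exy; have nc2 := ncE.2 u v y x Euv Eyx.
  have nc3 := ncE.2 x y u v Exy Euv; have nc4 := ncE.2 x y v u Exy Evu.
  apply: rect_pair_cases => //; last 4 first.
  - exact: ncE.1 u v x Euv.
  - exact: ncE.1 u v y Euv.
  - exact: ncE.1 x y u Exy.
  - exact: ncE.1 x y v Exy.
  - by rewrite !(inj_eq injf) !(inj_eq injg) ux uy vx vy.
  - by rewrite (inj_eq injg).
  - by rewrite (inj_eq injg).
case=> s s01 <- [t t01 [/= e1 e2]].
have ltn (r : R) (a b c d : nat) : 0 <= r <= 1 -> (a < c)%N -> (b < d)%N ->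
    (1 - r) * a%:R + r * b%:R < (1 - r) * c%:R + r * d%:R :> R.
  by move=> ? ? ?; apply: ltr_conv; rewrite ?ltr_nat.
have [/andP[s0 s1] /andP[t0 t1]] := (s01, t01).
have convC (r : R) (a b : nat) :
    (1 - r) * a%:R + r * b%:R = (1 - (1 - r)) * b%:R + (1 - r) * a%:R :> R by ring.
have incr (r r' : R) (a b : nat) : (a < b)%N ->
    (1 - r) * a%:R + r * b%:R < (1 - r') * a%:R + r' * b%:R -> r < r'.
  by move=> ?; apply: conv_lt_incr; rewrite ltr_nat.
have decr (r r' : R) (a b : nat) : (b < a)%N ->
    (1 - r) * a%:R + r * b%:R < (1 - r') * a%:R + r' * b%:R -> r' < r.
  by move=> ab; rewrite ![_ + _ * b%:R]convC => /(incr _ _ _ _ ab); lra.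
case/or4P: cases => [h|h|/and4P[h1 h2 h3 h4]|/or4P[/and4P[h1 h2 h3 h4]|||/orP[]]].
- suff : (1 - s) * (f u)%:R + s * (f v)%:R < (1 - t) * (f x)%:R + t * (f y)%:R :> R.
    by rewrite e1 ltxx.
  have uvx := ltn_trans fuv h.
  by apply: ltr_conv2 => //; rewrite ltr_nat // (ltn_trans _ fxy).
- suff : (1 - t) * (f x)%:R + t * (f y)%:R < (1 - s) * (f u)%:R + s * (f v)%:R :> R.
    by rewrite e1 ltxx.
  have xyu := ltn_trans fxy h.
  by apply: ltr_conv2 => //; rewrite ltr_nat // (ltn_trans _ fuv).
- suff : (1 - s) * (g u)%:R + s * (g v)%:R < (1 - t) * (g x)%:R + t * (g y)%:R :> R.
    by rewrite e2 ltxx.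
  by apply: ltr_conv2 => //; rewrite ltr_nat.
- suff : (1 - t) * (g x)%:R + t * (g y)%:R < (1 - s) * (g u)%:R + s * (g v)%:R :> R.
    by rewrite e2 ltxx.
  by apply: ltr_conv2 => //; rewrite ltr_nat.
(* In the last four cases the point with parameter [t] on [u v] is compared with the common point,
   whose parameter on [u v] is [s]. One coordinate gives [t < s], the other [s < t]. *)
- case/and5P=> h1 h2 h3 h4 /andP[h5 _].
  have := ltn t _ _ _ _ t01 h1 h2; have := ltn t _ _ _ _ t01 h3 h4.
  by rewrite e1 e2 => /(decr _ _ _ _ h5) ? /(incr _ _ _ _ fuv); lra.
- case/and5P=> h1 h2 h3 h4 /andP[h5 _].
  have := ltn t _ _ _ _ t01 h1 h2; have := ltn t _ _ _ _ t01 h3 h4.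
  by rewrite e1 e2 => /(decr _ _ _ _ h5) ? /(incr _ _ _ _ fuv); lra.
- case/and5P=> h1 h2 h3 h4 /andP[h5 _].
  have := ltn t _ _ _ _ t01 h1 h2; have := ltn t _ _ _ _ t01 h3 h4.
  by rewrite e1 e2 => /(incr _ _ _ _ h5) ? /(incr _ _ _ _ fuv); lra.
- case/and5P=> h1 h2 h3 h4 /andP[h5 _].
  have := ltn t _ _ _ _ t01 h1 h2; have := ltn t _ _ _ _ t01 h3 h4.
  by rewrite e1 e2 => /(incr _ _ _ _ h5) ? /(incr _ _ _ _ fuv); lra.
Qed.

Lemma noncrossing_planar : planar_drawing E pos.
Proof.
move=> u v x y Euv Exy ne z [zuv zxy].
have Evu : E v u by rewrite E_sym.
have Eyx : E y x by rewrite E_sym.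
have zvu := segmentC zuv; have zyx := segmentC zxy.
have [xu|ux] := eqVneq u x.
  exists u; first by rewrite xu; split; left.
  rewrite -xu in Exy zxy; apply/esym/(star_segments Euv Exy) => //.
  by apply/eqP => vy; case: ne; rewrite xu vy.
have [yu|uy] := eqVneq u y.
  exists u; first by split; [left|right].
  rewrite -yu in Eyx zyx; apply/esym/(star_segments Euv Eyx) => //.
  by apply/eqP => vx; case: ne; rewrite yu vx classical_sets.setUC.
have [xv|vx] := eqVneq v x.
  exists v; first by split; [right|left].
  rewrite -xv in Exy zxy; apply/esym/(star_segments Evu Exy) => //.
have [yv|vy] := eqVneq v y.
  exists v; first by split; right.
  rewrite -yv in Eyx zyx; apply/esym/(star_segments Evu Eyx) => //.
by case: (noncrossing_edges_disjoint Euv Exy _ zuv zxy); apply/and4P.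
Qed.

End NoncrossingPlanar.

(** * Extents from vertical lines *)

Section Links.
Variables (V : finType) (f g : V -> int) (E : rel V).

Local Notation desc := (descending f g).

(* A descending pair that could be joined by an edge without harming [E]. *)
Definition visible_link a b :=
  [&& desc a b, [forall w, ~~ in_rect f g a b w] &
      [forall p, forall q, E p q ==> ~~ cross f g a b p q && ~~ cross f g p q b a]].

Local Notation link := visible_link.

Lemma linkP a b : reflect [/\ desc a b, forall w, ~~ in_rect f g a b w &
    forall p q, E p q -> ~~ cross f g a b p q /\ ~~ cross f g p q b a] (link a b).
Proof.
apply: (iffP and3P) => -[ab h1 h2]; split=> //; try exact/forallP.
- by move=> p q Epq; have /forallP/(_ p)/forallP/(_ q) := h2; rewrite Epq => /andP.
- by apply/forallP => p; apply/forallP => q; apply/implyP => /h2 [-> ->].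
Qed.

Hypotheses (injf : injective f) (injg : injective g) (E_sym : symmetric E).
Hypothesis ncE : noncrossing f g E.

Lemma desc_edge_link a b : desc a b -> E a b -> link a b.
Proof.
move=> ab Eab; apply/linkP; split=> // [w|p q Epq]; first exact: ncE.1.
by split; apply: ncE.2; rewrite // E_sym.
Qed.

(* [u] is the highest vertex that sees [v] and is not cut off from it by an edge
   passing below. If an edge passing to the right cut it off, the next visible
   vertex [t] to the right would be cut off from below, and these edges cross. *)
Lemma uplink v w : desc w v -> exists u, link u v.
Proof.
move=> wv; pose N z := desc z v.
pose wide u := [exists p, exists q, E p q && cross f g p q v u].
pose empty u := [forall z, N z ==> ~~ ((f u < f z) && (g z < g u))].
pose P u := [&& N u, empty u & ~~ wide u].
(* The lowest vertex of [N] satisfies [P], as an edge passing between it and [v] would have its left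
   end in [N] and lower. So a highest vertex with [P] exists. *)
have [s1 Ns1 mins1] := @arg_minP _ _ _ w N g wv.
have Ps1 : P s1.
  apply/and3P; split=> //.
    apply/forallP => z; apply/implyP => Nz; have := mins1 z Nz; clear; lia.
  apply/negP => /existsP[p /existsP[q /andP[_ c]]].
  have : N p by move: c; rewrite /cross /N /descending; clear; lia.
  by move/mins1; move: c; rewrite /cross; clear; lia.
have [u Pu maxu] := @arg_maxP _ _ _ s1 P g Ps1; exists u.
have [Nu /forallP emptyu /negP wideu] := and3P Pu.
apply/linkP; split=> // [z|p q Epq].
  apply/negP => inz.
  have Nz : N z by move: inz Nu; rewrite /N /in_rect /between /descending; clear; lia.
  have := emptyu z; rewrite Nz; move: inz Nu.
  by rewrite /N /in_rect /between /descending; clear; lia.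
split; last first.
  apply/negP => c; apply: wideu; apply/existsP; exists p; apply/existsP; exists q.
  by rewrite Epq.
apply/negP => c.
have Nq : N q && (f u < f q) by move: c; rewrite /cross /N /descending; clear; lia.
have [t /andP[Nt fut] mint] := @arg_minP _ _ _ q (fun z => N z && (f u < f z)) g Nq.
have gut : g u < g t.
  have : g u != g t by rewrite (inj_eq injg); apply: contraTneq fut => ->; rewrite ltxx.
  by have := emptyu t; rewrite Nt fut; clear; lia.
have : ~~ P t by apply/negP => /maxu /=; move: gut; clear; lia.
have empt : empty t.
  apply/forallP => z; apply/implyP => Nz; apply/negP => /andP[h1 h2].
  have : N z && (f u < f z) by rewrite Nz; move: fut h1; clear; lia.
  by move/mint; move: h2; clear; lia.
rewrite /P Nt empt /= negbK => /existsP[p' /existsP[q' /andP[Epq' c']]].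
(* Otherwise [p'] would be a vertex of [N] to the right of [u] and lower than [t]. *)
have fpu : f p' <= f u.
  rewrite leNgt; apply/negP => h.
  have : N p' && (f u < f p').
    by rewrite h andbT; move: c'; rewrite /cross /N /descending; clear; lia.
  by move/mint; move: c'; rewrite /cross; clear; lia.
have gtq := mint q Nq.
have := ncE.2 p' q' p q Epq' Epq; apply/negP; rewrite negbK.
by move: c c' fpu gtq; rewrite /cross; clear; lia.
Qed.

(** A set can stand for the sequence of links because [desc] orders its members totally. The top
    member has no vertex above and to its left. *)
Record upchain (v : V) (C : {set V}) : Prop := Upchain {
  upchain_mem : v \in C;
  upchain_desc : forall a, a \in C -> a = v \/ desc a v;
  upchain_total : forall a b, a \in C -> b \in C -> a != b ->
    desc a b || desc b a;
  upchain_up : forall a, a \in C ->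
    (forall w, ~~ desc w a) \/ exists2 a', a' \in C & link a' a;
  upchain_down : forall a, a \in C -> a = v \/ exists2 b, b \in C & link a b }.

Lemma desc_trans : transitive desc.
Proof. by move=> b a c; rewrite /descending; clear; lia. Qed.

Lemma link_desc a b : link a b -> desc a b.
Proof. by case/linkP. Qed.

(** Following [uplink] strictly decreases the number of vertices above and to the left, which is the
    induction measure. *)
Lemma upchain_exists v : exists C, upchain v C.
Proof.
have [n] := ubnP #|[pred w | desc w v]|; elim: n v => // n IHn v ltn.
have [[w wv]|none] := pselect (exists w, desc w v); last first.
  exists [set v]%SET; split; first exact/set11.
  - by move=> a /set1P; left.
  - by move=> a b /set1P -> /set1P ->; rewrite eqxx.
  - by move=> a /set1P ->; left => w; apply/negP => wv; apply: none; exists w.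
  - by move=> a /set1P; left.
have [u luv] := uplink wv; have uv := link_desc luv.
have [|C [uC descC totC upC downC]] := IHn u.
  rewrite ltnS in ltn; apply: leq_trans ltn; apply: proper_card; apply/properP; split.
    by apply/fintype.subsetP => z; rewrite !inE => zu; exact: desc_trans zu uv.
  by exists u; rewrite !inE // /descending !ltxx.
have Cv a : a \in C -> desc a v.
  by move=> /descC[->|au] //; exact: desc_trans au uv.
exists (v |: C)%SET; split.
- exact: setU11.
- by move=> a /setU1P[|/Cv]; [left|right].
- move=> a b /setU1P[->|aC] /setU1P[->|bC]; first by rewrite eqxx.
  + by rewrite (Cv b) ?orbT.
  + by rewrite (Cv a).
  + exact: totC.
- move=> a /setU1P[->|/upC[?|[a' a'C la]]]; [right|by left|right].
    by exists u => //; apply/setU1P; right.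
  by exists a' => //; apply/setU1P; right.
- move=> a /setU1P[->|aC]; [by left|right].
  case: (downC a aC) => [->|[b bC lab]]; first by exists v; rewrite ?setU11.
  by exists b => //; apply/setU1P; right.
Qed.

End Links.

(** * Vertical lines and the cuts they define *)

Section Cuts.
Variables (V : finType) (f g : V -> int) (E : rel V).
Hypotheses (injf : injective f) (injg : injective g) (E_sym : symmetric E).
Hypothesis ncE : noncrossing f g E.

Local Notation asc := (ascending f g).
Local Notation desc := (descending f g).
Local Notation link := (visible_link f g E).

(** The half turn negating both coordinates keeps links and noncrossing but swaps up and down, so
    that upward chains yield downward ones. *)
Lemma opp_desc a b : descending (fun v => - f v) (fun v => - g v) a b = desc b a.
Proof. by rewrite /descending !ltrN2. Qed.

Lemma opp_in_rect a b w :
  in_rect (fun v => - f v) (fun v => - g v) a b w = in_rect f g b a w.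
Proof. by rewrite /in_rect /between !ltrN2; clear; lia. Qed.

Lemma opp_cross a b p q :
  cross (fun v => - f v) (fun v => - g v) a b p q = cross f g b a q p.
Proof. by rewrite /cross !ltrN2; clear; lia. Qed.

Lemma opp_link a b : visible_link (fun v => - f v) (fun v => - g v) E a b = link b a.
Proof.
apply/linkP/linkP; rewrite opp_desc => -[ab h1 h2]; split=> // [w|p q Epq].
- by have := h1 w; rewrite opp_in_rect.
- by have := h2 q p; rewrite !opp_cross E_sym Epq => -[].
- by rewrite opp_in_rect.
- by rewrite !opp_cross; apply: h2; rewrite E_sym.
Qed.

Lemma opp_noncrossing : noncrossing (fun v => - f v) (fun v => - g v) E.
Proof.
split=> [u v w Euv|u v x y Euv Exy].
  by rewrite opp_in_rect; apply: ncE.1; rewrite E_sym.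
by rewrite opp_cross; apply: ncE.2; rewrite E_sym.
Qed.

(* A maximal descending chain of links: the vertices met by a vertical line. *)
Record line (C : {set V}) : Prop := Line {
  line_total : forall a b, a \in C -> b \in C -> a != b -> desc a b || desc b a;
  line_up : forall a, a \in C ->
    (forall w, ~~ desc w a) \/ exists2 a', a' \in C & link a' a;
  line_down : forall a, a \in C ->
    (forall w, ~~ desc a w) \/ exists2 b, b \in C & link a b }.

(** An upward chain from [a] is joined to a downward chain from [b], which is an upward chain after
    the half turn. *)
Lemma line_exists a b : a = b \/ link a b ->
  exists C, [/\ line C, a \in C & b \in C].
Proof.
move=> ab.
have [C1 [aC1 descC1 totC1 upC1 downC1]] := upchain_exists injg ncE a.
have injNg : injective (fun v => - g v) by move=> u v /oppr_inj/injg.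
have [C2 [bC2 descC2 totC2 upC2 downC2]] := upchain_exists injNg opp_noncrossing b.
have d12 u v : u \in C1 -> v \in C2 -> u != v -> desc u v.
  move=> uC1 vC2 uv; have := descC2 v vC2; rewrite opp_desc => dv; move: ab.
  case: (descC1 u uC1) => [?|dua]; case: dv => [?|dbv]; subst.
  - by case=> [e|/link_desc//]; rewrite e eqxx in uv.
  - by case=> [->//|/link_desc dab]; exact: desc_trans dab dbv.
  - by case=> [<-//|/link_desc dab]; exact: desc_trans dua dab.
  - case=> [e|/link_desc dab]; first by subst; exact: desc_trans dua dbv.
    exact: desc_trans (desc_trans dua dab) dbv.
exists (C1 :|: C2)%SET; split; last first.
- by apply/setUP; right.
- by apply/setUP; left.
split.
- move=> u v /setUP[uC|uC] /setUP[vC|vC] uv; [exact: totC1|by rewrite d12| |].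
    by rewrite orbC d12 // eq_sym.
  by have := totC2 u v uC vC uv; rewrite !opp_desc orbC.
- move=> u /setUP[uC|uC].
    case: (upC1 u uC) => [|[u' u'C lu]]; [by left|right].
    by exists u' => //; apply/setUP; left.
  case: (downC2 u uC) => [->|[u' u'C]]; last first.
    by rewrite opp_link => lu; right; exists u' => //; apply/setUP; right.
  case: ab => [<-|lab]; last by right; exists a => //; apply/setUP; left.
  case: (upC1 a aC1) => [|[u' u'C lu]]; [by left|right].
  by exists u' => //; apply/setUP; left.
- move=> u /setUP[uC|uC]; last first.
    case: (upC2 u uC) => [h|[u' u'C lu]]; [left => w; by have := h w; rewrite opp_desc|right].
    by exists u'; [apply/setUP; right|rewrite -opp_link].
  case: (downC1 u uC) => [->|[u' u'C lu]]; last first.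
    by right; exists u' => //; apply/setUP; left.
  case: ab => [->|lab]; last by right; exists b => //; apply/setUP; right.
  case: (upC2 b bC2) => [h|[u' u'C lu]]; [left => w; by have := h w; rewrite opp_desc|right].
  by exists u'; [apply/setUP; right|rewrite -opp_link].
Qed.

Lemma comparable4 u v : u != v -> [|| asc u v, asc v u, desc u v | desc v u].
Proof.
rewrite -(inj_eq injf) => fuv.
have : g u != g v by rewrite (inj_eq injg); apply: contraNneq fuv => ->.
by move: fuv; rewrite /ascending /descending; clear; lia.
Qed.

(** The heights of [p] and [q] lie between those of [b] and [a]. Being outside the rectangle of the
    link, [p] must be to its left and [q] to its right. *)
Lemma tall_link_crosses a b p q :
    ~~ [&& f a < f p, f p < f b, g b < g p & g p < g a] ->
    ~~ [&& f a < f q, f q < f b, g b < g q & g q < g a] ->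
    f a != f p -> f b != f q -> f a < f q -> f p < f b ->
    g p < g a -> g q < g a -> g b < g p -> g b < g q ->
  cross f g p q b a.
Proof.
move=> np nq ap bq faq fpb gpa gqa gbp gbq.
move: np nq; rewrite /cross faq fpb gpa gqa gbp gbq /= !andbT -!leNgt.
by rewrite !le_eqVlt eq_sym (negPf ap) (negPf bq) /= => -> ->.
Qed.

(** The same argument with the axes exchanged: [p] must be below the rectangle and [q] above it. *)
Lemma wide_link_crosses a b p q :
    ~~ [&& f a < f p, f p < f b, g b < g p & g p < g a] ->
    ~~ [&& f a < f q, f q < f b, g b < g q & g q < g a] ->
    g a != g q -> g b != g p -> f a < f p -> f a < f q ->
    f p < f b -> f q < f b -> g p < g a -> g b < g q ->
  cross f g a b p q.
Proof.
move=> np nq aq bp fap faq fpb fqb gpa gbq.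
move: np nq; rewrite /cross fap faq fpb fqb gpa gbq /= !andbT -!leNgt.
by rewrite !le_eqVlt eq_sym (negPf aq) (negPf bp) /= => -> ->.
Qed.

Section Line.
Variable C : {set V}.
Hypothesis lineC : line C.

Lemma line_asc a b : a \in C -> b \in C -> ~~ asc a b.
Proof.
move=> aC bC; have [->|ab] := eqVneq a b; first by rewrite /ascending ltxx.
by have := line_total lineC aC bC ab; rewrite /ascending /descending; clear; lia.
Qed.

(** If members lie above and to the left of [p], the lower partner of the lowest of them is
    ascending-comparable to [p], as [p] is not in the rectangle of that link. If there are none, the
    topmost member is. *)
Lemma line_sides z0 p : z0 \in C -> p \notin C ->
  (exists2 z, z \in C & asc p z) \/ (exists2 z, z \in C & asc z p).
Proof.
move=> z0C pC.
suff [z zC] : exists2 z, z \in C & asc p z || asc z p.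
  by case/orP => ?; [left|right]; exists z.
have pz z : z \in C -> z != p by move=> zC; apply: contraNneq pC => <-.
have [[z1 z1C z1p]|none] := pselect (exists2 z, z \in C & desc z p).
  have [z /andP[zC zp] minz] := @arg_minP _ _ _ z1 (fun z => (z \in C) && desc z p) g
    (introT andP (conj z1C z1p)).
  case: (line_down lineC zC) => [/(_ p)|[b bC lzb]]; first by rewrite zp.
  exists b => //; case/linkP: (lzb) => zb /(_ p) nzbp _.
  have nbp : ~~ desc b p.
    apply/negP => bp; have := minz b; rewrite bC bp => /(_ isT).
    by move: zb; rewrite /descending; clear; lia.
  have := comparable4 (pz b bC); move: zp zb nzbp nbp.
  by rewrite /ascending /descending /in_rect /between; clear; lia.
have [z zC maxz] := @arg_maxP _ _ _ z0 (mem C) g z0C; exists z => //.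
have nzp : ~~ desc z p by apply/negP => zp; apply: none; exists z.
case: (line_up lineC zC) => [/(_ p)|[a aC /link_desc]].
  by have := comparable4 (pz z zC); move: nzp; rewrite /ascending /descending; clear; lia.
by have := maxz a aC; rewrite /= /descending; clear; lia.
Qed.

(** The members with [P] come first on the way down, so the link leaving the lowest of them is the
    one sought. *)
Lemma line_transition (P : pred V) z z' : z \in C -> z' \in C -> P z -> ~~ P z' ->
    (forall a b, a \in C -> b \in C -> P a -> ~~ P b -> desc a b) ->
  exists a b, [/\ link a b, a \in C, b \in C, P a & ~~ P b].
Proof.
move=> zC z'C Pz Pz' Pdesc.
have [a /andP[aC Pa] mina] := @arg_minP _ _ _ z (fun a => (a \in C) && P a) g
  (introT andP (conj zC Pz)).
case: (line_down lineC aC) => [|[b bC lab]].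
  by move/(_ z'); rewrite Pdesc.
exists a, b; split=> //; apply/negP => Pb.
have := mina b; rewrite bC Pb => /(_ isT).
by have := link_desc lab; rewrite /descending; clear; lia.
Qed.

(* A line having vertices on both sides of the edge [p, q] contains a link that
   jumps over it, i.e. crosses it or has [p] or [q] in its rectangle. *)
Lemma line_separates p q : E p q -> p \notin C ->
    (forall z, z \in C -> ~~ asc z p) -> (exists2 z, z \in C & asc z q) ->
  False.
Proof.
move=> Epq pC nzp [zj zjC zjq].
have [[zi ziC pzi]|[z zC zp]] := line_sides zjC pC; last by have := nzp z zC; rewrite zp.
have nqz z : z \in C -> ~~ asc q z.
  move=> zC; have := line_asc zjC zC; move: zjq; rewrite /ascending; clear; lia.
have qC : q \notin C by apply: contraL zjq => qC; exact: line_asc.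
have facts z : z \in C -> [&& f z != f p, g z != g p, f z != f q, g z != g q,
    ~~ asc z p, ~~ asc q z & ~~ in_rect f g p q z].
  move=> zC; rewrite nzp // nqz // (ncE.1 _ _ _ Epq) !(inj_eq injf) !(inj_eq injg).
  have zp : z != p by apply: contraNneq pC => <-.
  have zq : z != q by apply: contraNneq qC => <-.
  by rewrite zp zq.
have nji := line_asc zjC ziC.
have tot a b : a \in C -> b \in C -> [|| (f a == f b) && (g a == g b), desc a b | desc b a].
  move=> aC bC; rewrite (inj_eq injf) (inj_eq injg) andbb; have [//|ab] := eqVneq a b.
  by rewrite /=; exact: (line_total lineC).
have nlink a b : link a b ->
    [/\ ~~ [&& f a < f p, f p < f b, g b < g p & g p < g a],
        ~~ [&& f a < f q, f q < f b, g b < g q & g q < g a],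
        ~~ cross f g a b p q & ~~ cross f g p q b a].
  move=> /linkP[_ h1 /(_ p q Epq)[h2 h3]]; split=> //.
    by have := h1 p; rewrite /in_rect /between; clear; lia.
  by have := h1 q; rewrite /in_rect /between; clear; lia.
have contra (P : pred V) z z' : z \in C -> z' \in C -> P z -> ~~ P z' ->
    (forall a b, a \in C -> b \in C -> P a -> ~~ P b -> desc a b) ->
    (forall a b, a \in C -> b \in C -> P a -> ~~ P b -> ~~ link a b) -> False.
  move=> zC z'C Pz Pz' h1 h2.
  have [a [b [lab aC bC Pa Pb]]] := line_transition zC z'C Pz Pz' h1.
  by have := h2 a b aC bC Pa Pb; rewrite lab.
have pq : p != q.
  by apply: contraTneq pzi => pq; have := nqz zi ziC; rewrite pq.
case/or4P: (comparable4 pq) => /andP[fpq gpq].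
(* For an ascending edge, [P] marks the members to its upper left and [Q] those to its lower right.
   Of the four positions of a link from [P] to [Q], two put [p] or [q] into its rectangle and two
   make it cross the edge. *)
- pose P z := ((f z < f q) && (g q < g z)) || ((f z < f p) && (g p < g z)).
  pose Q z := ((f p < f z) && (g z < g p)) || ((f q < f z) && (g z < g q)).
  have notP z : z \in C -> ~~ P z -> Q z.
    move/facts; move: fpq gpq; rewrite /P /Q /ascending /in_rect /between; clear; lia.
  have Pdesc a b : a \in C -> b \in C -> P a -> ~~ P b -> desc a b.
    move=> aC bC Pa /(notP b bC); have := tot a b aC bC; move: fpq gpq Pa.
    by rewrite /P /Q /descending; clear; lia.
  have Plink a b : a \in C -> b \in C -> P a -> ~~ P b -> ~~ link a b.
    move=> aC bC Pa /(notP b bC) Qb; apply/negP => /nlink[np nq /negP nab /negP npq].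
    have /and5P[fa ga fa' ga' _] := facts a aC; have /and5P[fb gb fb' gb' _] := facts b bC.
    case/orP: Pa => /andP[a1 a2]; case/orP: Qb => /andP[b1 b2].
    - by apply: npq; apply: tall_link_crosses => //; [exact: lt_trans a2|exact: lt_trans gpq].
    - by move: nq; rewrite a1 b1 b2 a2.
    - by move: np; rewrite a1 b1 b2 a2.
    - by apply: nab; apply: wide_link_crosses => //; [exact: lt_trans fpq|exact: lt_trans b1].
  have [Pi|/(notP zi ziC) Pi] := boolP (P zi); have [Pj|Pj] := boolP (P zj).
  + by move: Pi Pj nji fpq gpq zjq pzi; rewrite /P /ascending; clear; lia.
  + exact: (contra P zi zj).
  + by apply: (contra P zj zi) => //; move: Pi fpq gpq; rewrite /P /Q; clear; lia.
  + have := notP zj zjC Pj.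
    by move: Pi nji fpq gpq zjq pzi; rewrite /Q /ascending; clear; lia.
- by move: nji fpq gpq zjq pzi; rewrite /ascending; clear; lia.
(* For a descending edge a single coordinate tells the two sides apart: here the members are above
   [p] or else below [q]. *)
- have low z : z \in C -> ~~ (g p < g z) -> (f p < f z) && (g z < g q).
    by move/facts; move: fpq gpq; rewrite /ascending /in_rect /between; clear; lia.
  apply: (contra (fun z => g p < g z) zi zj) => //.
  + by move: pzi; rewrite /ascending; clear; lia.
  + by move: zjq gpq; rewrite /ascending; clear; lia.
  + by move=> a b aC bC; have := tot a b aC bC; rewrite /descending; clear; lia.
  + move=> a b aC bC gpa /(low b bC)/andP[fpb gbq]; apply/negP => /nlink[np nq _ /negP npq].
    have /and5P[fa ga fa' ga' /and3P[_ nqa _]] := facts a aC.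
    have faq : f a < f q.
      by move: nqa fa' gpa gpq; rewrite /ascending; clear; lia.
    have /and5P[_ _ fb _ _] := facts b bC.
    by apply: npq; apply: tall_link_crosses => //; [exact: lt_trans gpa|exact: lt_trans gpq].
- have right z : z \in C -> ~~ (f z < f q) -> (f p < f z) && (g z < g q).
    by move/facts; move: fpq gpq; rewrite /ascending /in_rect /between; clear; lia.
  apply: (contra (fun z => f z < f q) zj zi) => //.
  + by move: zjq; rewrite /ascending; clear; lia.
  + by move: pzi fpq; rewrite /ascending; clear; lia.
  + by move=> a b aC bC; have := tot a b aC bC; rewrite /descending; clear; lia.
  + move=> a b aC bC faq /(right b bC)/andP[fpb gbq]; apply/negP => /nlink[np nq /negP nab _].
    have /and5P[fa ga fa' ga' /and3P[nap _ _]] := facts a aC.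
    have gpa : g p < g a.
      by move: nap ga faq fpq; rewrite /ascending; clear; lia.
    have /and5P[_ gb _ _ _] := facts b bC.
    by apply: nab; apply: wide_link_crosses => //; [exact: lt_trans fpq|exact: lt_trans fpb].
Qed.

End Line.

(* For a vertical line in the layout, [S.1] holds the vertices whose left side is
   beyond it and [S.2] those whose right side is. *)
Definition is_cut (S : {set V} * {set V}) :=
  [forall p, (p \in S.1) ==> (p \in S.2)] &&
  [forall p, forall q, ((p \in S.2) && asc p q ==> (q \in S.1)) &&
                       (E p q && (q \in S.1) ==> (p \in S.2))].

Lemma is_cutP (S : {set V} * {set V}) : reflect [/\ forall p, p \in S.1 -> p \in S.2,
    forall p q, p \in S.2 -> asc p q -> q \in S.1 &
    forall p q, E p q -> q \in S.1 -> p \in S.2] (is_cut S).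
Proof.
apply: (iffP andP) => [[/forallP h1 /forallP h2]|[h1 h2 h3]]; split.
- by move=> p; apply/implyP.
- move=> p q pS pq; have /forallP/(_ q)/andP[/implyP h _] := h2 p.
  by apply: h; rewrite pS.
- move=> p q Epq qS; have /forallP/(_ q)/andP[_ /implyP h] := h2 p.
  by apply: h; rewrite Epq.
- by apply/forallP => p; apply/implyP; exact: h1.
- apply/forallP => p; apply/forallP => q; apply/andP; split; apply/implyP => /andP[].
    exact: h2.
  exact: h3.
Qed.

(** The cut of a line has beyond it the vertices that ascend from a member; the members themselves
    are the vertices it passes through. Its condition on edges is [line_separates]. *)
Lemma cut_exists a b : a = b \/ link a b ->
  exists S : {set V} * {set V}, [/\ is_cut S, a \notin S.1, b \notin S.1, a \in S.2 & b \in S.2].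
Proof.
move=> /line_exists[C [lineC aC bC]].
pose B := [set p | [exists z, (z \in C) && asc z p]]%SET.
have BP p : reflect (exists2 z, z \in C & asc z p) (p \in B).
  rewrite inE; apply: (iffP existsP) => [[z /andP[]]|[z zC zp]]; first by exists z.
  by exists z; rewrite zC.
exists (B, B :|: C)%SET; split=> /=; last 2 first.
- by apply/setUP; right.
- by apply/setUP; right.
- apply/is_cutP; split=> /=.
  + by move=> p pB; apply/setUP; left.
  + move=> p q /setUP[/BP[z zC zp]|pC] pq; apply/BP; last by exists p.
    by exists z => //; move: zp pq; rewrite /ascending; clear; lia.
  + move=> p q Epq /BP qB; apply/negPn/negP; rewrite inE negb_or => /andP[pB pC].
    apply: (line_separates lineC Epq pC _ qB) => z zC.
    by apply: contra pB => zp; apply/BP; exists z.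
- by apply/BP => -[z zC]; apply/negP; exact: (line_asc lineC).
- by apply/BP => -[z zC]; apply/negP; exact: (line_asc lineC).
Qed.

(** The sides [l v] and [r v] count the cuts having [v] in [S.1] and in [S.2], so the weak
    inequalities are inclusions between sets of cuts. They are strict where some cut passes through
    the vertices concerned. *)
Lemma cut_coordinates : exists l r : V -> nat,
  [/\ forall v, (l v < r v)%N,
      forall u v, asc u v -> (r u <= l v)%N,
      forall u v, asc u v -> E u v -> r u = l v &
      forall u v, desc u v -> E u v -> (l u < r v)%N /\ (l v < r u)%N].
Proof.
pose l v := #|[set S : {set V} * {set V} | is_cut S & v \in S.1]%SET|.
pose r v := #|[set S : {set V} * {set V} | is_cut S & v \in S.2]%SET|.
have lr u v S : (u = v \/ E u v) -> is_cut S -> u \notin S.1 -> v \in S.2 -> (l u < r v)%N.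
  move=> uv cutS uS vS; apply: proper_card; apply/properP; split.
    apply/fintype.subsetP => T; rewrite !inE => /andP[cutT]; rewrite cutT /=.
    case/is_cutP: cutT => h1 _ h3; case: uv => [->|Euv]; first exact: h1.
    by apply: h3; rewrite E_sym.
  by exists S; rewrite !inE ?cutS // (negPf uS).
have rl u v : asc u v -> (r u <= l v)%N.
  move=> uv; apply: subset_leq_card; apply/fintype.subsetP => T; rewrite !inE.
  by move=> /andP[cutT]; rewrite cutT /=; case/is_cutP: cutT => _ h2 _ /h2; apply.
exists l, r; split=> //.
- move=> v; have [|S [cutS vS1 _ vS2 _]] := @cut_exists v v; first by left.
  by apply: (lr _ _ S) => //; left.
- move=> u v uv Euv; apply/eqP; rewrite eqn_leq rl //=.
  apply: subset_leq_card; apply/fintype.subsetP => T; rewrite !inE.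
  by move=> /andP[cutT]; rewrite cutT /=; case/is_cutP: cutT => _ _; apply.
- move=> u v uv Euv; have luv := desc_edge_link E_sym ncE uv Euv.
  have [|S [cutS uS1 vS1 uS2 vS2]] := @cut_exists u v; first by right.
  by split; apply: (lr _ _ S) => //; right; rewrite // E_sym.
Qed.

End Cuts.

(** * Layouts in general position *)

Lemma smaller_than_positives (R : realType) (s : seq R) :
  exists2 e : R, 0 < e & {in s, forall x, 0 < x -> e < x}.
Proof.
elim: s => [|x s [e e0 IHs]]; first by exists 1.
have [x0|x0] := ltP 0 x; last first.
  by exists e => // y; rewrite inE => /orP[/eqP->|/IHs//]; rewrite ltNge x0.
exists (Num.min e (x / 2)); first by rewrite lt_min e0 divr_gt0.
move=> y; rewrite inE => /orP[/eqP->|ys] y0; rewrite gt_min.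
  by apply/orP; right; lra.
by rewrite (IHs _ ys y0).
Qed.

(** Shifts by at most [e] will preserve all these strict inequalities at once. *)
Lemma uniform_gap (R : realType) (V : finType) (a b : V -> R) :
  exists2 e : R, 0 < e & forall u v, a u < b v -> a u + e < b v.
Proof.
have [e e0 he] := smaller_than_positives [seq b p.2 - a p.1 | p : V * V].
exists e => // u v; rewrite -subr_gt0 => /he.
rewrite ltrBrDl; apply; exact: (image_f (fun p : V * V => b p.2 - a p.1) (x := (u, v))).
Qed.

Lemma share_segmentC (R : realType) (r s : rectangle R) :
  share_segment r s -> share_segment s r.
Proof. by move=> [p [q [pq sub]]]; exists p, q; rewrite classical_sets.setIC. Qed.

Lemma overlap_interval (R : realType) (a b c d : R) : a < b -> c < d -> a < d -> c < b ->
  exists x y, [/\ x < y, a <= x, c <= x, y <= b & y <= d].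
Proof.
move=> ab cd ad cb; exists (Num.max a c), (Num.min b d).
by rewrite le_max lexx le_max lexx orbT ge_min lexx ge_min lexx orbT; split=> //;
   rewrite lt_min !gt_max ab cb ad cd.
Qed.

Lemma share_segment_vertical (R : realType) (r s : rectangle R) :
    xmax r = xmin s -> ymin r < ymax s -> ymin s < ymax r -> share_segment r s.
Proof.
have := (xmin_lt_xmax r, xmin_lt_xmax s) => -[xr xs] rs h1 h2.
have [y [y' [yy' h3 h4 h5 h6]]] := overlap_interval (ymin_lt_ymax r) (ymin_lt_ymax s) h1 h2.
exists (xmax r, y), (xmax r, y'); split=> [[e]|z [t /andP[t0 t1] <-]].
  by rewrite e ltxx in yy'.
by split; split=> [|[/=]]; rewrite /rect_closed /=; [split; nra|nra|split; nra|nra].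
Qed.

Lemma share_segment_horizontal (R : realType) (r s : rectangle R) :
    ymax r = ymin s -> xmin r < xmax s -> xmin s < xmax r -> share_segment r s.
Proof.
have := (ymin_lt_ymax r, ymin_lt_ymax s) => -[yr ys] rs h1 h2.
have [x [x' [xx' h3 h4 h5 h6]]] := overlap_interval (xmin_lt_xmax r) (xmin_lt_xmax s) h1 h2.
exists (x, ymax r), (x', ymax r); split=> [[e]|z [t /andP[t0 t1] <-]].
  by rewrite e ltxx in xx'.
by split; split=> [|[/=]]; rewrite /rect_closed /=; [split; nra|nra|split; nra|nra].
Qed.

Section GenericLayout.
Variables (R : realType) (V : finType).
Implicit Types (l r b t : V -> R) (E : rel V).

Definition touch l r b t u v : bool := [&& r u == l v, b u < t v & b v < t u].

Definition contact l r b t u v : bool :=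
  [|| touch l r b t u v, touch l r b t v u, touch b t l r u v | touch b t l r v u].

Definition separated l r b t u v : bool :=
  [|| r u < l v, r v < l u, t u < b v | t v < b u].

(** Non-adjacent rectangles are strictly apart, without even a common corner, so that small shifts
    create no contact. *)
Definition generic_layout l r b t E :=
  [/\ forall v, l v < r v, forall v, b v < t v &
      forall u v, u != v ->
        if E u v then contact l r b t u v else separated l r b t u v].

Lemma generic_layoutC l r b t E : generic_layout l r b t E -> generic_layout b t l r E.
Proof.
case=> lr bt uvE; split=> // u v /uvE; case: ifP => _.
  by rewrite /contact orbA orbC -orbA.
by rewrite /separated orbA orbC -orbA.
Qed.

Definition remove_edge E a c : rel V :=
  fun u v => E u v && ~~ ((u == a) && (v == c) || (u == c) && (v == a)).

(** Moving the sides that hang together with [c] to the right opens a gap after [a]. On the common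
    line, the sides above follow whichever of [a] and [c] reaches higher, those below whichever
    reaches lower. The shift is too small to affect other strict inequalities. *)
Lemma remove_touch l r b t E a c :
    generic_layout l r b t E -> a != c -> touch l r b t a c ->
  exists l' r', generic_layout l' r' b t (remove_edge E a c).
Proof.
move=> [lr bt uvE] ac /and3P[/eqP rlac bac bca].
have [e1 e10 he1] := uniform_gap l r; have [e2 e20 he2] := uniform_gap r l.
pose e := Num.min e1 e2.
have e0 : 0 < e by rewrite lt_min e10.
have he u v : l u < r v -> l u + e < r v.
  by move=> /he1; apply: le_lt_trans; rewrite lerD2l ge_min lexx.
have he' u v : r u < l v -> r u + e < l v.
  by move=> /he2; apply: le_lt_trans; rewrite lerD2l ge_min lexx orbT.
(* The contacts on the line through the sides of [a] and [c] form a forest;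
   [sR] and [sL] tell which sides are still connected to [c] without [a, c]. *)
pose sR u := if r u == r a then
    (if u == a then false else if t a <= b u then t a <= t c else b c <= b a) else false.
pose sL v := if l v == r a then
    (if v == c then true else if t c <= b v then t a <= t c else b c <= b a) else false.
pose r' u := if sR u then r u + e else r u.
pose l' v := if sL v then l v + e else l v.
have rr' u : r u <= r' u <= r u + e by rewrite /r'; case: ifP => _; lra.
have ll' u : l u <= l' u <= l u + e by rewrite /l'; case: ifP => _; lra.
have disj u v : u != v -> l u < r v -> l v < r u -> (t u <= b v) || (t v <= b u).
  move=> /uvE; case: ifP => _; rewrite /contact /separated /touch; lra.
(* Any other two sides touching on the line move together. Rectangles on the same side of the line
   do not overlap vertically, which decides what is above [a] or [c] and what is below. *)
have sRL u v : u != v -> ~~ ((u == a) && (v == c)) -> touch l r b t u v -> sR u = sL v.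
  move=> uv nac /and3P[/eqP ruv buv bvu]; rewrite /sR /sL -ruv; case: eqP => // ru.
  have lru := lr u; have lrv := lr v; have lra' := lr a; have lrc := lr c.
  have [ua|ua] := eqVneq u a; have [vc|vc] := eqVneq v c.
  - by rewrite ua vc !eqxx in nac.
  - have := disj v c vc; subst u => /(_ ltac:(lra) ltac:(lra)) dvc.
    by case: (leP (t c)) => h; apply/esym/negbTE; rewrite -ltNge; lra.
  - have := disj u a ua; subst v => /(_ ltac:(lra) ltac:(lra)) dua.
    by case: (leP (t a) (b u)) => h; lra.
  - have := disj u a ua ltac:(lra) ltac:(lra).
    have := disj v c vc ltac:(lra) ltac:(lra).
    by case: (leP (t a) (b u)) => h; case: (leP (t c) (b v)) => h' //; lra.
have sep u v : separated l r b t u v -> separated l' r' b t u v.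
  have := rr' u; have := rr' v; have := ll' u; have := ll' v => h1 h2 h3 h4.
  case/or4P=> [/he' h|/he' h|h|h]; apply/or4P.
  - by apply: Or41; lra.
  - by apply: Or42; lra.
  - exact: Or43.
  - exact: Or44.
have tch u v : u != v -> ~~ ((u == a) && (v == c)) -> touch l r b t u v ->
    touch l' r' b t u v.
  move=> uv nac tuv; have suv := sRL u v uv nac tuv; move: tuv => /and3P[/eqP ruv buv bvu].
  by apply/and3P; split=> //; rewrite /r' /l' suv ruv.
have tch' u v : touch b t l r u v -> touch b t l' r' u v.
  move=> /and3P[tb /he luv /he lvu]; apply/and3P; split=> //.
    by have := rr' v; have := ll' u; lra.
  by have := rr' u; have := ll' v; lra.
have rac : r' a < l' c.
  by rewrite /r' /l' /sR /sL -rlac !eqxx; lra.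
exists l', r'; split=> // [v|u v uv].
  by have := he _ _ (lr v); have := rr' v; have := ll' v; lra.
have := uvE _ _ uv; rewrite /remove_edge; case: (E u v) => /=; last exact: sep.
case: ifP => [|/negbFE/orP[]/andP[/eqP-> /eqP->] _]; last 2 first.
- by rewrite /separated rac.
- by rewrite /separated rac orbT.
rewrite negb_or => /andP[n1 n2] /or4P[] h; apply/or4P.
- by apply: Or41; exact: tch.
- by apply: Or42; apply: tch => //; [rewrite eq_sym|rewrite andbC].
- by apply: Or43; exact: tch'.
- by apply: Or44; exact: tch'.
Qed.

Lemma remove_contact l r b t E a c :
    generic_layout l r b t E -> a != c -> E a c ->
  exists l' r' b' t', generic_layout l' r' b' t' (remove_edge E a c).
Proof.
move=> G ac Eac; have [_ _ /(_ a c ac)] := G; rewrite Eac.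
have ext l' r' b' t' F F' : F =2 F' ->
    generic_layout l' r' b' t' F -> generic_layout l' r' b' t' F'.
  by move=> FF' [? ? uvF]; split=> // u v /uvF; rewrite FF'.
have remC : remove_edge E c a =2 remove_edge E a c.
  by move=> u v; rewrite /remove_edge orbC.
have ca : c != a by rewrite eq_sym.
case/or4P=> h.
- by have [l' [r' G']] := remove_touch G ac h; exists l', r', b, t.
- by have [l' [r' G']] := remove_touch G ca h; exists l', r', b, t; exact: ext G'.
- have [b' [t' G']] := remove_touch (generic_layoutC G) ac h.
  by exists l, r, b', t'; exact: generic_layoutC.
- have [b' [t' G']] := remove_touch (generic_layoutC G) ca h.
  by exists l, r, b', t'; apply: generic_layoutC; exact: ext G'.
Qed.

Lemma generic_layout_contact_graph l r b t E : generic_layout l r b t E ->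
  rectangle_contact_graph R E.
Proof.
case=> lr bt uvE; exists (fun v => Rectangle (lr v) (bt v)); split=> u v /eqP uv.
  have := uvE u v uv => h; apply/classical_sets.seteqP; split=> // -[x y] /=.
  move=> [[/= /andP[x1 x2] /andP[y1 y2]] [/= /andP[x3 x4] /andP[y3 y4]]].
  by move: h; case: ifP => _; rewrite /contact /separated /touch; lra.
split=> [[p [q [pq sub]]]|Euv].
  have [[[/= /andP[x1 x2] /andP[y1 y2]] _] [[/= /andP[x3 x4] /andP[y3 y4]] _]] : 
    (rect_boundary (Rectangle (lr u) (bt u)) `&` rect_boundary (Rectangle (lr v) (bt v)))%classic p.
    apply: sub; exists 0; first by rewrite /= lexx ler01.
    by case: (p) => p1 p2; congr pair; rewrite /=; ring.
  by have := uvE u v uv; case: ifP => // _; rewrite /separated; lra.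
have := uvE u v uv; rewrite Euv => /or4P[]/and3P[/eqP h1 h2 h3].
- exact: share_segment_vertical.
- exact/share_segmentC/share_segment_vertical.
- exact: share_segment_horizontal.
- exact/share_segmentC/share_segment_horizontal.
Qed.
End GenericLayout.

(** * From drawings to layouts *)

Section NoncrossingToLayout.
Variables (R : realType) (V : finType) (f g : V -> int).
Hypotheses (injf : injective f) (injg : injective g).

Local Notation asc := (ascending f g).
Local Notation desc := (descending f g).

(** Both orders of [u] and [v] are tested, since [cross] depends on the order within each pair. *)
Definition addable (E : rel V) u v :=
  [&& u != v, ~~ E u v, [forall w, ~~ in_rect f g u v w] &
      [forall x, forall y, E x y ==>
         [&& ~~ cross f g u v x y, ~~ cross f g v u x y,
             ~~ cross f g x y u v & ~~ cross f g x y v u]]].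

Lemma addableP E u v : reflect [/\ u != v, ~~ E u v, forall w, ~~ in_rect f g u v w &
    forall x y, E x y -> [&& ~~ cross f g u v x y, ~~ cross f g v u x y,
                             ~~ cross f g x y u v & ~~ cross f g x y v u]]
  (addable E u v).
Proof.
apply: (iffP and4P) => -[h1 h2 h3 h4]; split=> //; try exact/forallP.
- by move=> x y Exy; have /forallP/(_ x)/forallP/(_ y) := h4; rewrite Exy.
- by apply/forallP => x; apply/forallP => y; apply/implyP; exact: h4.
Qed.

(** Reflection exchanges ascending and descending pairs, and keeps [cross] once the ends of the
    piercing edge are swapped. *)
Lemma flip_noncrossing E : symmetric E -> noncrossing f g E ->
  noncrossing f (fun v => - g v) E.
Proof.
move=> E_sym ncE; split=> [u v w /(ncE.1 u v w)|u v x y Euv Exy].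
  by rewrite /in_rect /between !ltrN2; clear; lia.
have := ncE.2 u v y x Euv; rewrite E_sym => /(_ Exy).
by rewrite /cross !ltrN2; clear; lia.
Qed.

(** Ascending edges become contacts along vertical sides, descending ones along horizontal sides. A
    non-adjacent pair cannot be added, so a vertex or an edge blocks it, and either obstacle keeps
    the two rectangles strictly apart. *)
Lemma maximal_generic_layout E : symmetric E -> noncrossing f g E ->
    (forall u v, ~~ addable E u v) ->
  exists l r b t : V -> R, generic_layout l r b t E.
Proof.
move=> E_sym ncE maxE.
have [l [r [lr lr_asc lr_ascE lr_descE]]] := cut_coordinates injf injg E_sym ncE.
have injNg : injective (fun v => - g v) by move=> u v /oppr_inj/injg.
have [b [t [bt bt_asc bt_ascE bt_descE]]] :=
  cut_coordinates injf injNg E_sym (flip_noncrossing E_sym ncE).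
have flip_asc u v : ascending f (fun v => - g v) u v = desc u v.
  by rewrite /ascending ltrN2.
have flip_desc u v : descending f (fun v => - g v) u v = asc u v.
  by rewrite /descending ltrN2.
have bt_desc u v : desc u v -> (t u <= b v)%N by rewrite -flip_asc; exact: bt_asc.
have E_desc u v : desc u v -> E u v -> [&& t u == b v, l u < r v & l v < r u]%N.
  move=> uv Euv; have [-> ->] := lr_descE _ _ uv Euv.
  by rewrite (bt_ascE u v) ?eqxx // flip_asc.
have E_asc u v : asc u v -> E u v -> [&& r u == l v, b u < t v & b v < t u]%N.
  move=> uv Euv; have [|-> ->] := bt_descE u v _ Euv; first by rewrite flip_desc.
  by rewrite (lr_ascE u v) ?eqxx.
pose sep u v := [|| r u < l v, r v < l u, t u < b v | t v < b u]%N.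
have sepC u v : sep u v = sep v u by rewrite /sep; clear; lia.
(* An ascending blocking edge overlaps strictly in the vertical direction, a descending one in the
   horizontal direction. In that direction [u] and [v] lie on opposite sides of the overlap. *)
have sep_cross u v x y : E x y -> cross f g u v x y || cross f g x y u v -> sep u v.
  move=> Exy /orP[] c.
    have ux : desc u x by move: c; rewrite /cross /descending; clear; lia.
    have uy : asc u y by move: c; rewrite /cross /ascending; clear; lia.
    have xv : asc x v by move: c; rewrite /cross /ascending; clear; lia.
    have yv : desc y v by move: c; rewrite /cross /descending; clear; lia.
    have [xy|yx] : asc x y \/ desc y x.
    - have : x != y by apply: contraTneq c => ->; rewrite /cross; clear; lia.
      by move/(comparable4 injf injg); move: c; rewrite /cross /ascending /descending; clear; lia.
    - have := E_asc _ _ xy Exy; move: (bt_desc _ _ ux) (bt_desc _ _ yv).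
      by rewrite /sep; clear; lia.
    - rewrite E_sym in Exy; have := E_desc _ _ yx Exy; move: (lr_asc _ _ uy) (lr_asc _ _ xv).
      by rewrite /sep; clear; lia.
  have xu : desc x u by move: c; rewrite /cross /descending; clear; lia.
  have xv : asc x v by move: c; rewrite /cross /ascending; clear; lia.
  have uy : asc u y by move: c; rewrite /cross /ascending; clear; lia.
  have vy : desc v y by move: c; rewrite /cross /descending; clear; lia.
  have [xy|xy] : asc x y \/ desc x y.
  - have : x != y by apply: contraTneq c => ->; rewrite /cross; clear; lia.
    by move/(comparable4 injf injg); move: c; rewrite /cross /ascending /descending; clear; lia.
  - have := E_asc _ _ xy Exy; move: (bt_desc _ _ xu) (bt_desc _ _ vy).
    by rewrite /sep; clear; lia.
  - have := E_desc _ _ xy Exy; move: (lr_asc _ _ xv) (lr_asc _ _ uy).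
    by rewrite /sep; clear; lia.
(* The positive extent of [w] lies between the two rectangles. *)
have sep_in u v w : in_rect f g u v w -> sep u v.
  have := lr w; have := bt w => btw lrw.
  case/andP=> /orP[]/andP[f1 f2] /orP[]/andP[g1 g2].
  - have := lr_asc u w; have := lr_asc w v; rewrite /ascending f1 f2 g1 g2.
    by move: lrw; rewrite /sep; clear; lia.
  - have := bt_desc u w; have := bt_desc w v; rewrite /descending f1 f2 g1 g2.
    by move: btw; rewrite /sep; clear; lia.
  - have := bt_desc v w; have := bt_desc w u; rewrite /descending f1 f2 g1 g2.
    by move: btw; rewrite /sep; clear; lia.
  - have := lr_asc v w; have := lr_asc w u; rewrite /ascending f1 f2 g1 g2.
    by move: lrw; rewrite /sep; clear; lia.
exists (fun v => (l v)%:R), (fun v => (r v)%:R), (fun v => (b v)%:R), (fun v => (t v)%:R).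
split=> [v|v|u v uv]; rewrite ?ltr_nat // /contact /separated /touch !eqr_nat !ltr_nat.
have [Euv|nEuv] := boolP (E u v).
  have Evu : E v u by rewrite E_sym.
  case/or4P: (comparable4 injf injg uv) =>
    [/E_asc/(_ Euv)|/E_asc/(_ Evu)|/E_desc/(_ Euv)|/E_desc/(_ Evu)] ->;
  by rewrite ?orbT.
rewrite -/(sep u v); apply/negPn/negP => nsep; have /negP := maxE u v; apply.
apply/addableP; split=> // [w|x y Exy]; first by apply: contra nsep; exact: sep_in.
have nsep' : ~~ sep v u by rewrite sepC.
have := contra (sep_cross u v x y Exy) nsep; have := contra (sep_cross v u x y Exy) nsep'.
by rewrite !negb_or => /andP[-> ->] /andP[-> ->].
Qed.

(** Induction on the number of non-adjacent pairs: an addable edge is added, the larger graph is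
    laid out, and the extra contact is then removed. *)
Lemma noncrossing_generic_layout E : symmetric E -> irreflexive E -> noncrossing f g E ->
  exists l r b t : V -> R, generic_layout l r b t E.
Proof.
have [n] := ubnP #|[pred p : V * V | ~~ E p.1 p.2]|.
elim: n E => // n IHn E ltn E_sym E_irr ncE.
have [[u [v uvadd]]|noadd] := pselect (exists u v, addable E u v); last first.
  by apply: maximal_generic_layout => // u v; apply/negP => ?; apply: noadd; exists u, v.
have [uv nEuv emptyuv crossuv] := addableP _ _ _ uvadd.
pose F : rel V := fun x y => [|| E x y, (x == u) && (y == v) | (x == v) && (y == u)].
have Fuv : F u v by rewrite /F !eqxx orbT.
have [|||| l [r [b [t G]]]] := IHn F.
- rewrite ltnS in ltn; apply: leq_trans ltn; apply: proper_card; apply/properP; split.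
    by apply/fintype.subsetP => -[x y]; rewrite !inE /= negb_or => /andP[].
  by exists (u, v); rewrite !inE ?Fuv.
- move=> x y; rewrite /F E_sym [(x == u) && _]andbC [(x == v) && _]andbC.
  by rewrite [X in _ || X]orbC.
- move=> x; rewrite /F E_irr /= !(andbC (x == v)) orbb.
  by apply/negP => /andP[/eqP-> ]; rewrite (negPf uv).
- split=> [x y w /or3P[Exy|/andP[/eqP-> /eqP->]|/andP[/eqP-> /eqP->]]|].
  + exact: ncE.1.
  + exact: emptyuv.
  + by have := emptyuv w; rewrite /in_rect /between; clear; lia.
  + have nuv u' v' x' y' : ((u', v') == (u, v)) || ((u', v') == (v, u)) ->
        ((x', y') == (u, v)) || ((x', y') == (v, u)) -> ~~ cross f g u' v' x' y'.
      by move=> /orP[]/eqP[-> ->] /orP[]/eqP[-> ->]; rewrite /cross; clear; lia.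
    have nE u' v' x' y' : ((u', v') == (u, v)) || ((u', v') == (v, u)) -> E x' y' ->
        ~~ cross f g u' v' x' y' && ~~ cross f g x' y' u' v'.
      by move=> /orP[]/eqP[-> ->] /crossuv/and4P[? ? ? ?]; apply/andP.
    move=> x y x' y' /orP[Exy|xyuv] /orP[Exy'|xyuv'].
    * exact: ncE.2.
    * by have /andP[] := nE x' y' x y xyuv' Exy.
    * by have /andP[] := nE x y x' y' xyuv Exy'.
    * exact: nuv.
have [l' [r' [b' [t' G']]]] := remove_contact G uv Fuv.
exists l', r', b', t'; case: G' => h1 h2 h3; split=> // x y xy.
have -> : E x y = remove_edge F u v x y; last exact: h3.
rewrite /remove_edge /F.
case: (boolP ((x == u) && (y == v) || (x == v) && (y == u))) =>
  [/orP[]/andP[/eqP-> /eqP->]|_]; last by rewrite orbF andbT.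
  by rewrite (negPf nEuv) andbF.
by rewrite E_sym (negPf nEuv) andbF.
Qed.

End NoncrossingToLayout.

(** * Noncrossing coordinates from a drawing *)

Lemma crossing_segments_meet (R : realType) (u v x y : R * R) :
    u.1 < x.1 -> u.1 < y.1 -> x.1 < v.1 -> y.1 < v.1 ->
    x.2 < u.2 -> x.2 < v.2 -> u.2 < y.2 -> v.2 < y.2 ->
  exists z, segment u v z /\ segment x y z.
Proof.
case: u v x y => u1 u2 [v1 v2] [x1 x2] [y1 y2] /= h1 h2 h3 h4 h5 h6 h7 h8.
(* Cramer's rule: the lines meet at parameters [S / D] and [T / D]. Both lie in the unit interval
   because [S], [T], [D - S] and [D - T] are sums of products of positive differences. *)
set D := (v1 - u1) * (y2 - x2) - (v2 - u2) * (y1 - x1).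
set S := (x1 - u1) * (y2 - x2) - (x2 - u2) * (y1 - x1).
set T := (x1 - u1) * (v2 - u2) - (x2 - u2) * (v1 - u1).
have pos2 (a b c d : R) : 0 < a -> 0 < b -> 0 < c -> 0 < d -> 0 < a * b + c * d.
  by move=> *; rewrite addr_gt0 ?mulr_gt0.
have S0 : 0 < S.
  have -> : S = (x1 - u1) * (y2 - u2) + (u2 - x2) * (y1 - u1) by rewrite /S; ring.
  by apply: pos2; rewrite subr_gt0.
have SD : 0 < D - S.
  have -> : D - S = (v1 - x1) * (y2 - v2) + (v2 - x2) * (v1 - y1) by rewrite /S /D; ring.
  by apply: pos2; rewrite subr_gt0.
have T0 : 0 < T.
  have -> : T = (x1 - u1) * (v2 - x2) + (u2 - x2) * (v1 - x1) by rewrite /T; ring.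
  by apply: pos2; rewrite subr_gt0.
have TD : 0 < D - T.
  have -> : D - T = (v1 - y1) * (y2 - u2) + (y2 - v2) * (y1 - u1) by rewrite /T /D; ring.
  by apply: pos2; rewrite subr_gt0.
have D0 : 0 < D by lra.
have D0' : D != 0 by rewrite gt_eqF.
exists ((1 - S / D) * u1 + S / D * v1, (1 - S / D) * u2 + S / D * v2); split.
  exists (S / D) => //=; apply/andP; split; first by rewrite divr_ge0 // ltW.
  by rewrite ler_pdivrMr // mul1r; lra.
exists (T / D) => /=.
  apply/andP; split; first by rewrite divr_ge0 // ltW.
  by rewrite ler_pdivrMr // mul1r; lra.
by congr pair; move: D0'; rewrite /S /T /D => ?; field.
Qed.

(** Ranks determine positions only up to ties, which closed rectangles tolerate. In a crossing, a
    tie would put an end of one edge on the boundary of the rectangle of the other. So all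
    inequalities are strict, the segments meet, and planarity is violated. *)
Lemma drawing_noncrossing (R : realType) (V : finType) (E : rel V) (pos : V -> R * R) :
    weak_closed_RI_drawing E pos -> planar_drawing E pos ->
  exists f g : V -> nat, [/\ injective f, injective g &
    noncrossing (Posz \o f) (Posz \o g) E].
Proof.
move=> [_ emptyE] planarE.
have [f injf fx] := injective_refinement (fun v => (pos v).1).
have [g injg gy] := injective_refinement (fun v => (pos v).2).
have xf u v : (f u < f v)%N -> (pos u).1 <= (pos v).1.
  by move=> fuv; rewrite leNgt; apply/negP => /fx; lia.
have yg u v : (g u < g v)%N -> (pos u).2 <= (pos v).2.
  by move=> guv; rewrite leNgt; apply/negP => /gy; lia.
exists f, g; split=> //; split=> [u v w Euv|u v x y Euv Exy].
  apply/negP => /andP[/= fuwv guwv].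
  have [] : w = u \/ w = v.
    apply: (emptyE u v Euv); split; rewrite ge_min le_max.
      by case/orP: fuwv => /andP[/xf -> /xf ->]; rewrite ?orbT.
    by case/orP: guwv => /andP[/yg -> /yg ->]; rewrite ?orbT.
  - by move=> e; move: fuwv; rewrite e /between; clear; lia.
  - by move=> e; move: fuwv; rewrite e /between; clear; lia.
apply/negP => /and5P[/= f1 f2 f3 f4 /and4P[g1 g2 g3 g4]].
have neq : [&& u != x, u != y, v != x & v != y].
  apply/and4P; split; [move: f1|move: f2|move: f3|move: f4];
    by apply: contraTneq => ->; rewrite ltxx.
have /and4P[ux uy vx vy] := neq.
have out (a b c : V) : E a b -> c != a -> c != b -> ~ influence_rect (pos a) (pos b) (pos c).
  by move=> Eab ca cb /(emptyE _ _ Eab)[] /eqP; rewrite ?(negPf ca) ?(negPf cb).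
have [z [zuv zxy]] : exists z, segment (pos u) (pos v) z /\ segment (pos x) (pos y) z.
  have hx1 := xf _ _ f1; have hx2 := xf _ _ f2; have hx3 := xf _ _ f3; have hx4 := xf _ _ f4.
  have hy1 := yg _ _ g1; have hy2 := yg _ _ g2; have hy3 := yg _ _ g3; have hy4 := yg _ _ g4.
  have := out x y u Exy ux uy; have := out x y v Exy vx vy.
  have := out u v x Euv; rewrite eq_sym ux eq_sym vx => /(_ isT isT).
  have := out u v y Euv; rewrite eq_sym uy eq_sym vy => /(_ isT isT).
  rewrite /influence_rect /= !ge_min !le_max.
  move=> n1 n2 n3 n4; apply: crossing_segments_meet; rewrite ltNge; apply/negP => h.
  - by apply: n4; split; lra.
  - by apply: n4; split; lra.
  - by apply: n3; split; lra.
  - by apply: n3; split; lra.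
  - by apply: n2; split; lra.
  - by apply: n2; split; lra.
  - by apply: n1; split; lra.
  - by apply: n1; split; lra.
have [||w [wuv wxy] _] := planarE u v x y Euv Exy _ z.
- move=> e; have : ([set x; y] : set V)%classic u by rewrite -e; left.
  by move=> [] /eqP; rewrite ?(negPf ux) ?(negPf uy).
- by split.
move: ux uy vx vy; case: wuv => <-; case: wxy => <-; rewrite eqxx //.
Qed.

Theorem theorem3 (R : realType) (V : finType) (E : rel V)
    (E_sym : symmetric E) (E_irr : irreflexive E)
    (E_connected : forall u v : V, connect E u v)
    (V_card : (4 <= #|V|)%N) :
  rectangle_contact_graph R E <-> has_planar_weak_closed_RI_drawing R E.
Proof.
split=> [[rho lay]|[pos [ri planar]]].
  have [f [g [injf injg nc]]] := layout_noncrossing E_irr lay.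
  exists (fun v => ((f v)%:R, (g v)%:R)); split.
    exact: noncrossing_weak_closed_RI.
  exact: noncrossing_planar.
have [f [g [injf injg nc]]] := drawing_noncrossing ri planar.
have injF : injective (Posz \o f) by move=> u v [/injf].
have injG : injective (Posz \o g) by move=> u v [/injg].
have [l [r [b [t G]]]] := noncrossing_generic_layout R injF injG E_sym E_irr nc.
exact: generic_layout_contact_graph G.
Qed.
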